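(* Let $(M_1,\Delta_1),\ldots,(M_h,\Delta_h)$ be homogeneous Garside monoids, all distinct from $M(1,1)$, let $M=M_1*_\Delta\cdots*_\Delta M_h$ be their $\Delta$-product and let $i\in\{1,\ldots,h\}$. The natural morphism $\varphi_i:G(M_i)\to G(M)$ preserves left-weighted factorizations: if $\Delta_i^ks_1\cdots s_r$ is the left-weighted factorization of $x\in G(M_i)$, then $\Delta^k\varphi_i(s_1)\cdots\varphi_i(s_r)$ is the left-weighted factorization of $\varphi_i(x)$ in $G(M)$. In particular, $\varphi_i$ is injective.
   Context: A monoid $M$ is homogeneous if there is a monoid morphism $M\to(\mathbb{Z}_{\geq 0},+)$ such that the elements of positive image generate $M$. Let $M$ be homogeneous and cancellative. Write $a\preceq b$ if $b=ac$ for some $c\in M$ (left-divisibility) and $b\succeq a$ if $b=ca$ for some $c\in M$ (right-divisibility). $(M,\Delta)$ is a homogeneous Garside monoid if $(M,\preceq)$ and $(M,\succeq)$ are lattices and $\Delta\in M$ has equal sets of left- and right-divisors, this set $S$ being finite and generating $M$. Elements of $S$ are called simple elements, and $a\wedge b$ denotes the left-gcd. $M$ embeds in its enveloping group $G(M)$. A word $s_1\cdots s_r$ in $S$ is greedy if $s_j=(s_js_{j+1})\wedge\Delta$ for all $1\leq j<r$. The left-weighted factorization of $x\in G(M)$ is its unique decomposition $x=\Delta^ks_1\cdots s_r$ with $k\in\mathbb{Z}$, $r\geq 0$, $s_j\in S\setminus\{1,\Delta\}$, and $s_1\cdots s_r$ greedy. The $\Delta$-product $M=M_1*_\Delta\cdots*_\Delta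 M_h$ ($h\geq 1$) is the quotient of the free product of monoids $M_1*\cdots*M_h$ by the relations $\Delta_i=\Delta_j$ for all $i,j$. Let $\Delta\in M$ be the common image of the $\Delta_i$. It is known that $(M,\Delta)$ is a homogeneous Garside monoid, whose set of simple elements is the union of the images of the sets of simple elements of the $M_i$. The natural monoid morphism $M_i\to M$ and the induced group morphism $G(M_i)\to G(M)$ are both denoted by $\varphi_i$. $M(1,1)$ denotes the monoid $\mathbb{Z}_{\geq 0}$ with Garside element its generator; ''distinct from $M(1,1)$'' means that $(M_i,\Delta_i)$ is not isomorphic to it as a monoid with distinguished Garside element. *)

(* Defs.v *)
From HB Require Import structures.
From mathcomp Require Import all_boot all_algebra.
From mathcomp Require Import boolp.

Set Implicit Arguments.
Unset Strict Implicit.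
Unset Printing Implicit Defensive.

Local Open Scope quotient_scope.
Local Open Scope group_scope.

Section MonoidQuotient.
Variables (N : monoidType) (r : N -> N -> Prop).

(* The least monoid congruence containing [r]. *)
Inductive mcong : N -> N -> Prop :=
| MCongBase x y : r x y -> mcong x y
| MCongRefl x : mcong x x
| MCongSym x y : mcong x y -> mcong y x
| MCongTrans x y z : mcong x y -> mcong y z -> mcong x z
| MCongMul x x' y y' : mcong x x' -> mcong y y' -> mcong (x * y) (x' * y').

Definition mcongb : rel N := fun x y => `[< mcong x y >].

Lemma mcongb_refl : reflexive mcongb.
Proof. by move=> x; apply/asboolP; apply: MCongRefl. Qed.

Lemma mcongb_sym : symmetric mcongb.
Proof. by move=> x y; apply/asboolP/asboolP; apply: MCongSym. Qed.

Lemma mcongb_trans : transitive mcongb.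
Proof.
by move=> y x z /asboolP xy /asboolP yz; apply/asboolP; apply: MCongTrans xy yz.
Qed.

Canonical mcong_equiv := EquivRel mcongb mcongb_refl mcongb_sym mcongb_trans.

Definition mquot : Type := {eq_quot mcong_equiv}.
HB.instance Definition _ := Choice.on mquot.

Definition mquot_pi (x : N) : mquot := \pi_{eq_quot mcong_equiv} x.
Definition mquot_repr (x : mquot) : N := repr (x : {eq_quot mcong_equiv}).

Lemma mquot_reprK : cancel mquot_repr mquot_pi.
Proof. exact: reprK. Qed.

Lemma mquotP (x y : N) : mquot_pi x = mquot_pi y <-> mcong x y.
Proof. by split=> [/eqmodP/asboolP|xy] //; apply/eqmodP/asboolP. Qed.

Definition mquot_one : mquot := mquot_pi 1.
Definition mquot_mul (x y : mquot) : mquot :=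
  mquot_pi (mquot_repr x * mquot_repr y).

Lemma mquot_mulE (x y : N) :
  mquot_mul (mquot_pi x) (mquot_pi y) = mquot_pi (x * y).
Proof. by apply/mquotP/MCongMul; apply/mquotP; rewrite mquot_reprK. Qed.

Lemma mquot_mulA : associative mquot_mul.
Proof.
move=> x y z; rewrite -[x]mquot_reprK -[y]mquot_reprK -[z]mquot_reprK.
by rewrite !mquot_mulE mulgA.
Qed.

Lemma mquot_mul1 : left_id mquot_one mquot_mul.
Proof. by move=> x; rewrite -[x]mquot_reprK mquot_mulE mul1g. Qed.

Lemma mquot_mulr1 : right_id mquot_one mquot_mul.
Proof. by move=> x; rewrite -[x]mquot_reprK mquot_mulE mulg1. Qed.

HB.instance Definition _ :=
  isMonoid.Build mquot mquot_mulA mquot_mul1 mquot_mulr1.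

Lemma mquot_piM : {morph mquot_pi : x y / x * y}.
Proof. by move=> x y; rewrite -[LHS]mquot_mulE. Qed.

Lemma mquot_pi1 : mquot_pi 1 = 1.
Proof. by []. Qed.

HB.instance Definition _ :=
  isUMagmaMorphism.Build N mquot mquot_pi (conj mquot_pi1 mquot_piM).

End MonoidQuotient.

Definition free_monoid (X : Type) : Type := seq X.

HB.instance Definition _ (X : choiceType) := Choice.on (free_monoid X).
HB.instance Definition _ (X : choiceType) :=
  isMonoid.Build (free_monoid X) (@catA X) (@cat0s X) (@cats0 X).

Section DeltaProduct.
Variables (I : choiceType) (M : I -> monoidType).

Inductive free_product_rel :
  free_monoid {i : I & M i} -> free_monoid {i : I & M i} -> Prop :=
| FreeProductOne i : free_product_rel [:: Tagged M (1 : M i)] [::]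
| FreeProductMul i (x y : M i) :
    free_product_rel [:: Tagged M x; Tagged M y] [:: Tagged M (x * y)].

Definition free_product : Type := mquot free_product_rel.
HB.instance Definition _ := Monoid.on free_product.

Definition free_product_in (i : I) (x : M i) : free_product :=
  mquot_pi free_product_rel [:: Tagged M x].

Variable Delta : forall i, M i.

Inductive delta_product_rel : free_product -> free_product -> Prop :=
| DeltaProductRel i j :
    delta_product_rel (free_product_in (Delta i)) (free_product_in (Delta j)).

Definition delta_product : Type := mquot delta_product_rel.
HB.instance Definition _ := Monoid.on delta_product.

Definition dp_in (i : I) (x : M i) : delta_product :=
  mquot_pi delta_product_rel (free_product_in x).

Lemma dp_in1 i : dp_in (1 : M i) = 1.
Proof.
rewrite -[RHS](mquot_pi1 delta_product_rel); congr (mquot_pi _ _).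
by apply/mquotP/MCongBase/FreeProductOne.
Qed.

Lemma dp_inM i : {morph @dp_in i : x y / x * y}.
Proof.
move=> x y; rewrite /dp_in -[RHS]mquot_piM; congr (mquot_pi _ _).
rewrite /free_product_in -[RHS]mquot_piM; apply/mquotP/MCongSym/MCongBase.
exact: FreeProductMul.
Qed.

HB.instance Definition _ i :=
  isUMagmaMorphism.Build (M i) delta_product (@dp_in i)
    (conj (dp_in1 i) (@dp_inM i)).

(* The image of [Delta i] in the Delta-product; it does not depend on [i]. *)
Definition dp_delta (i : I) : delta_product := dp_in (Delta i).

Lemma dp_delta_common i j : dp_delta i = dp_delta j.
Proof. by apply/mquotP/MCongBase/DeltaProductRel. Qed.

End DeltaProduct.

Section Enveloping.
Variable M : monoidType.

(* The letter [(false, a)] stands for [a] and [(true, a)] for its inverse. *)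
Inductive env_rel :
  free_monoid (bool * M)%type -> free_monoid (bool * M)%type -> Prop :=
| EnvMul a b : env_rel [:: (false, a); (false, b)] [:: (false, a * b)]
| EnvInvr a : env_rel [:: (false, a); (true, a)] [::]
| EnvInvl a : env_rel [:: (true, a); (false, a)] [::].

Definition env_group : Type := mquot env_rel.
HB.instance Definition _ := Monoid.on env_group.

Definition env_pi (w : free_monoid (bool * M)%type) : env_group :=
  mquot_pi env_rel w.

Definition env_repr (x : env_group) : free_monoid (bool * M)%type :=
  mquot_repr (x : mquot env_rel).

Lemma env_reprK : cancel env_repr env_pi.
Proof. exact: mquot_reprK. Qed.

Lemma env_piP w w' : env_pi w = env_pi w' <-> mcong env_rel w w'.
Proof. exact: mquotP. Qed.

Lemma env_piM w w' : env_pi (w ++ w') = env_pi w * env_pi w'.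
Proof. exact: mquot_piM. Qed.

Lemma env_pi1 : env_pi [::] = 1.
Proof. by []. Qed.

Definition env_inv_word (w : free_monoid (bool * M)%type) :
  free_monoid (bool * M)%type := rev [seq (~~ p.1, p.2) | p <- w].

Lemma env_inv_wordl w : env_pi (env_inv_word w) * env_pi w = 1.
Proof.
elim: w => [|[b a] w IHw]; first by rewrite mulg1.
rewrite /env_inv_word /= rev_cons -cats1 env_piM (env_piM [:: (b, a)] w).
rewrite -mulgA (mulgA (env_pi [:: (~~ b, a)])) -(env_piM [:: _])
  [X in _ * (X * _)](_ : _ = 1) ?mul1g //.
rewrite -env_pi1; apply/env_piP/MCongBase.
by case: b => /=; [exact: EnvInvr|exact: EnvInvl].
Qed.

Lemma env_inv_wordK : involutive env_inv_word.
Proof.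
move=> w; rewrite /env_inv_word map_rev revK -map_comp.
by rewrite -[RHS]map_id; apply: eq_map => -[b a] /=; rewrite negbK.
Qed.

Definition env_inv (x : env_group) : env_group :=
  env_pi (env_inv_word (env_repr x)).

Lemma env_mulVg (x : env_group) : env_inv x * x = 1.
Proof.
by rewrite -{2}[x]env_reprK /env_inv env_inv_wordl.
Qed.

Lemma env_mulgV (x : env_group) : x * env_inv x = 1.
Proof.
rewrite -{1}[x]env_reprK /env_inv.
by rewrite -{1}[env_repr x]env_inv_wordK env_inv_wordl.
Qed.

HB.instance Definition _ := hasInv.Build env_group env_inv.
HB.instance Definition _ := Monoid_isGroup.Build env_group env_mulVg env_mulgV.

Definition env_in (a : M) : env_group := env_pi [:: (false, a)].

Lemma env_inM : {morph env_in : a b / a * b}.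
Proof.
move=> a b; rewrite /env_in -env_piM.
by apply/env_piP/MCongSym/MCongBase/EnvMul.
Qed.

Lemma env_in1 : env_in 1 = 1.
Proof. by apply: (mulgI (env_in 1)); rewrite -env_inM !mulg1. Qed.

HB.instance Definition _ :=
  isUMagmaMorphism.Build M env_group env_in (conj env_in1 env_inM).

End Enveloping.

Section EnvelopingMap.
Variables (M N : monoidType) (f : UMagmaMorphism.type M N).

(* The group morphism G(M) -> G(N) induced by [f], applied letter by letter to
   a representative; [env_map_pi] shows that the choice of the latter does not
   matter, and [env_map_in] that [env_map] extends [f]. *)
Definition env_map (x : env_group M) : env_group N :=
  env_pi [seq (p.1, f p.2) | p <- env_repr x].

Lemma env_map_pi w : env_map (env_pi w) = env_pi [seq (p.1, f p.2) | p <- w].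
Proof.
suff map_mcong u v : mcong (@env_rel M) u v ->
    mcong (@env_rel N) [seq (p.1, f p.2) | p <- u] [seq (p.1, f p.2) | p <- v].
  by apply/env_piP/map_mcong/env_piP; rewrite env_reprK.
elim=> {u v} [u v|u|u v _|u v t _ + _|u u' v v' _ + _].
- case=> [a b|a|a] /=; apply: MCongBase.
  + by rewrite gmulfM; apply: EnvMul.
  + exact: EnvInvr.
  + exact: EnvInvl.
- exact: MCongRefl.
- exact: MCongSym.
- exact: MCongTrans.
- by move=> uu' vv'; rewrite !map_cat; apply: MCongMul.
Qed.

Lemma env_map_in a : env_map (env_in a) = env_in (f a).
Proof. exact: env_map_pi. Qed.

Lemma env_mapM : {morph env_map : x y / x * y}.
Proof.
move=> x y; rewrite -[x]env_reprK -[y]env_reprK -env_piM !env_map_pi.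
by rewrite map_cat env_piM.
Qed.

Lemma env_map1 : env_map 1 = 1.
Proof. by rewrite -env_pi1 env_map_pi. Qed.

HB.instance Definition _ :=
  isUMagmaMorphism.Build (env_group M) (env_group N) env_map
    (conj env_map1 env_mapM).

End EnvelopingMap.

(* The additive monoid of natural numbers, written multiplicatively as the
   library requires. *)
Definition nat_add : Type := nat.
HB.instance Definition _ := Choice.on nat_add.
HB.instance Definition _ := isMonoid.Build nat_add addnA add0n addn0.

Section Garside.
Variable M : monoidType.
Implicit Types (a b c d Delta : M) (s : seq M).

Definition generates (P : M -> Prop) : Prop :=
  forall a, exists2 s, (forall b, b \in s -> P b) & a = \prod_(b <- s) b.

Definition homogeneous : Prop :=
  exists l : UMagmaMorphism.type M nat_add,
    generates (fun a => (0 < (l a : nat))%N).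

Definition cancellative : Prop :=
  (forall a b c, a * b = a * c -> b = c) /\
  (forall a b c, b * a = c * a -> b = c).

Definition ldvd a b : Prop := exists c, b = a * c.
Definition rdvd a b : Prop := exists c, b = c * a.

Definition is_glb (le : M -> M -> Prop) a b d : Prop :=
  [/\ le d a, le d b & forall c, le c a -> le c b -> le c d].
Definition is_lub (le : M -> M -> Prop) a b d : Prop :=
  [/\ le a d, le b d & forall c, le a c -> le b c -> le d c].

Record is_lattice (le : M -> M -> Prop) : Prop := IsLattice {
  lattice_refl : forall a, le a a;
  lattice_antisym : forall a b, le a b -> le b a -> a = b;
  lattice_trans : forall a b c, le a b -> le b c -> le a c;
  lattice_glb : forall a b, exists d, is_glb le a b d;
  lattice_lub : forall a b, exists d, is_lub le a b d }.

Definition simple Delta a : Prop := ldvd a Delta.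

Record homogeneous_garside Delta : Prop := HomogeneousGarside {
  garside_homogeneous : homogeneous;
  garside_cancellative : cancellative;
  garside_llattice : is_lattice ldvd;
  garside_rlattice : is_lattice rdvd;
  garside_divisors : forall a, ldvd a Delta <-> rdvd a Delta;
  garside_finite : exists s, forall a, simple Delta a -> a \in s;
  garside_generates : generates (simple Delta) }.

(* [is_glb ldvd (a * b) Delta a] reads a = (a * b) /\ Delta (left-gcd). *)
Definition greedy Delta s : Prop :=
  (forall a, a \in s -> simple Delta a) /\
  (forall j, (j.+1 < size s)%N ->
     is_glb ldvd (nth 1 s j * nth 1 s j.+1) Delta (nth 1 s j)).

End Garside.

Definition zexpg (G : groupType) (x : G) (k : int) : G :=
  match k with Posz n => x ^+ n | Negz n => x ^- n.+1 end.

(* [k] and [s] are the exponent and the word of the left-weighted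
   factorization of [x] with respect to [Delta]; for a homogeneous Garside monoid
   with [Delta <> 1] there is exactly one such pair. *)
Definition left_weighted (M : monoidType) (Delta : M)
    (x : env_group M) (k : int) (s : seq M) : Prop :=
  [/\ x = zexpg (env_in Delta) k * \prod_(a <- s) env_in a,
      forall a, a \in s -> [/\ simple Delta a, a <> 1 & a <> Delta]
    & greedy Delta s].

Definition garside_iso (M N : monoidType) (DM : M) (DN : N) : Prop :=
  exists f : UMagmaMorphism.type M N, bijective f /\ f DM = DN.

(* The monoid M(1,1) is [nat_add], with Garside element its generator. *)
Definition M11_delta : nat_add := 1%N.

(* Main.v *)
From HB Require Import structures.
Require Import Defs.
From mathcomp Require Import all_boot all_algebra.
From mathcomp Require Import boolp.

Set Implicit Arguments.
Unset Strict Implicit.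
Unset Printing Implicit Defensive.

Local Open Scope group_scope.

(** The [Delta]-product [M] is an amalgam of the [M i] along the cyclic monoids
    generated by the [Delta i], and the proof is van der Waerden's: [M] acts on
    a set of normal forms from which everything can be read off.

    In a homogeneous Garside monoid every element is uniquely [Delta ^+ m * v]
    with [v] not divisible by [Delta]: the length bounds [m], and cancellation
    gives uniqueness. Moreover [Delta] can be moved across any element at the
    price of a twist. Allowing negative exponents, the pairs (k, v), which stand
    for [Delta ^ k * v], carry an action of the monoid on which [Delta] acts by
    the shift of [k] ([garside_act]).

    A normal form for [M] is an integer [k] together with a word of nontrivial,
    [Delta]-free letters taken from the [M i], neighbours coming from distinct
    components. Each [M i] acts on the exponent and on the leading letter when
    that letter lies in [M i], a missing letter being read as [1]. All the
    [Delta i] act by the same shift, so the universal property of the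
    [Delta]-product yields an action of [M] ([nf_morphism]), and every element
    acts bijectively because every simple element is a two-sided factor of
    [Delta i]. Three consequences carry the theorem.

    - Acting on the empty normal form shows that [M] acts faithfully and that the
      natural maps [phi] are injective. As the action is by bijections, it
      extends to [G(M)], and so the natural map from [M] to [G(M)] is injective.
      Elements of [G(M i)] have a power of [Delta i] as common denominator, hence
      the induced map [G(M i)] to [G(M)] is injective ([env_map_phi_inj]).
    - If [phi c] left-divides [phi z] in [M] with [c], [z] in the same component,
      then [c] left-divides [z] ([phi_ldvd]); if the components differ, then
      [c = 1] or [Delta] left-divides [z] ([phi_ldvd_neq]).
    - Therefore all divisors of [Delta] in [M] come from simple elements of some
      [M j] ([simple_delta_product]), and a common left-divisor of [Delta] and
      [phi (a * b)] either comes from a common divisor in [M i], or is trivial, or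
      forces [a = Delta i]. So greedy pairs stay greedy ([phi_greedy_pair]). *)

(** * Self-maps as a monoid, and invertible elements *)

(** The composition monoid of self-maps: an action of a monoid on [X] is a
    morphism into [endo X]. The alias keeps this structure apart from other
    structures on function types. *)
Definition endo (X : Type) : Type := X -> X.

Section EndoMonoid.
Variable X : Type.

HB.instance Definition _ := gen_eqMixin (endo X).
HB.instance Definition _ := gen_choiceMixin (endo X).

Definition endo_mul (f g : endo X) : endo X := f \o g.
Definition endo_one : endo X := id.

Lemma endo_mulA : associative endo_mul. Proof. by []. Qed.
Lemma endo_mul1 : left_id endo_one endo_mul. Proof. by []. Qed.
Lemma endo_mulr1 : right_id endo_one endo_mul. Proof. by []. Qed.

HB.instance Definition _ :=
  isMonoid.Build (endo X) endo_mulA endo_mul1 endo_mulr1.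

End EndoMonoid.

Definition invertible (E : monoidType) (e : E) : Prop :=
  exists e', e' * e = 1 /\ e * e' = 1.

Lemma invertibleM (E : monoidType) (e f : E) :
  invertible e -> invertible f -> invertible (e * f).
Proof.
move=> [e' [e'e ee']] [f' [f'f ff']]; exists (f' * e'); split.
  by rewrite mulgA -(mulgA f') e'e mulg1.
by rewrite mulgA -(mulgA e) ff' mulg1.
Qed.

(** A left inverse and a right inverse, here obtained from the two factorizations
    of [d], necessarily agree. *)
Lemma invertible_of_factor (E : monoidType) (d s t t' : E) :
  invertible d -> s * t = d -> t' * s = d -> invertible s.
Proof.
move=> [d' [d'd dd']] st t's.
have ls : d' * t' * s = 1 by rewrite -mulgA t's.
have rs : s * (t * d') = 1 by rewrite mulgA st.
exists (d' * t'); split=> //.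
by rewrite -[LHS]mulg1 -{1}rs -!mulgA (mulgA d') (mulgA (d' * t')) ls mul1g rs.
Qed.

(** * Universal properties *)

Lemma mcong_morph (N P : monoidType) (r : N -> N -> Prop)
    (f : UMagmaMorphism.type N P) (x y : N) :
  (forall x y, r x y -> f x = f y) -> mcong r x y -> f x = f y.
Proof.
move=> fr; elim=> {x y} //; first by move=> x y z _ -> _ ->.
by move=> x x' y y' _ fx _ fy; rewrite !gmulfM fx fy.
Qed.

Definition mquot_lift (N P : monoidType) (r : N -> N -> Prop) (f : N -> P)
  (x : mquot r) : P := f (mquot_repr x).

Lemma mquot_liftP (N P : monoidType) (r : N -> N -> Prop)
    (f : UMagmaMorphism.type N P) :
  (forall x y, r x y -> f x = f y) ->
  exists F : UMagmaMorphism.type (mquot r) P,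
    forall x, F (mquot_pi r x) = f x.
Proof.
move=> fr; have liftE x : mquot_lift f (mquot_pi r x) = f x.
  by apply: (mcong_morph fr); apply/mquotP; rewrite mquot_reprK.
have lift1 : mquot_lift f (1 : mquot r) = 1 by rewrite -mquot_pi1 liftE gmulf1.
have liftM : {morph @mquot_lift N P r f : x y / x * y}.
  move=> x y; rewrite -[x]mquot_reprK -[y]mquot_reprK -mquot_piM !liftE.
  exact: gmulfM.
pose mix := isUMagmaMorphism.Build _ _ (@mquot_lift N P r f) (conj lift1 liftM).
by exists (HB.pack_for (UMagmaMorphism.type (mquot r) P)
  (@mquot_lift N P r f) mix) => x; apply: liftE.
Qed.

Lemma free_monoid_liftP (X : choiceType) (P : monoidType) (g : X -> P) :
  exists F : UMagmaMorphism.type (free_monoid X) P,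
    forall w, F w = \prod_(x <- w) g x.
Proof.
pose F (w : free_monoid X) := \prod_(x <- w) g x.
have F1 : F 1 = 1 by exact: big_nil.
have FM : {morph F : u v / u * v} by move=> u v; apply: big_cat.
pose mix := isUMagmaMorphism.Build _ _ F (conj F1 FM).
by exists (HB.pack_for (UMagmaMorphism.type (free_monoid X) P) F mix).
Qed.

Lemma delta_product_liftP (I : choiceType) (M : I -> monoidType)
    (Delta : forall i, M i) (P : monoidType) (f : forall i, M i -> P) :
  (forall i, f i 1 = 1) -> (forall i, {morph f i : x y / x * y}) ->
  (forall i j, f i (Delta i) = f j (Delta j)) ->
  exists F : UMagmaMorphism.type (delta_product Delta) P,
    forall i (x : M i), F (dp_in Delta x) = f i x.
Proof.
move=> f1 fM fD.
have [F0 F0E] := free_monoid_liftP (fun p : {i : I & M i} =>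
  f (tag p) (tagged p)).
have [|F1 F1E] := @mquot_liftP _ P (@free_product_rel I M) F0.
  by move=> _ _ [i|i x y]; rewrite !F0E ?big_cons !big_nil /= ?f1 ?fM ?mulg1.
have F1in i (x : M i) : F1 (free_product_in x) = f i x.
  by rewrite F1E F0E big_seq1.
have [|F F2E] := @mquot_liftP _ P (delta_product_rel Delta) F1.
  by move=> _ _ [i j]; rewrite !F1in.
by exists F => i x; rewrite F2E F1in.
Qed.

(** A morphism with invertible values factors through the enveloping group,
    where [(true, c)] is sent to an inverse of [f c]. Hence [f] cannot separate
    elements that the enveloping group identifies. *)
Lemma env_in_eq_morph (N E : monoidType) (f : UMagmaMorphism.type N E)
    (a b : N) :
  (forall c, invertible (f c)) -> env_in a = env_in b -> f a = f b.
Proof.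
move=> finv; pose g c := sval (cid (finv c)).
have gP c : g c * f c = 1 /\ f c * g c = 1 by exact: (svalP (cid (finv c))).
pose letter (p : bool * N) := if p.1 then g p.2 else f p.2.
have [F FE] := free_monoid_liftP letter.
move=> /env_piP ab; suff: F [:: (false, a)] = F [:: (false, b)].
  by rewrite !FE !big_seq1.
apply: mcong_morph ab => _ _ [c d|c|c];
  rewrite !FE ?big_cons !big_nil /letter /= ?mulg1 ?gmulfM //;
  by case: (gP c).
Qed.

Lemma delta_product_indr (I : choiceType) (M : I -> monoidType)
    (Delta : forall i, M i) (P : delta_product Delta -> Prop) :
  P 1 -> (forall i (a : M i) y, P y -> P (y * dp_in Delta a)) ->
  forall y, P y.
Proof.
move=> P1 PM y; rewrite -[y]mquot_reprK -[mquot_repr y]mquot_reprK.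
elim/last_ind: (mquot_repr (mquot_repr y)) => [|w [i a] IHw]; first exact: P1.
rewrite -cats1 (mquot_piM _ (w : free_monoid {i : I & M i}) [:: Tagged M a]).
by rewrite mquot_piM; apply: PM.
Qed.

Lemma delta_product_ind (I : choiceType) (M : I -> monoidType)
    (Delta : forall i, M i) (P : delta_product Delta -> Prop) :
  P 1 -> (forall i (a : M i) y, P y -> P (dp_in Delta a * y)) ->
  forall y, P y.
Proof.
move=> P1 PM y; rewrite -[y]mquot_reprK -[mquot_repr y]mquot_reprK.
elim: (mquot_repr (mquot_repr y)) => [|[i a] w IHw]; first exact: P1.
rewrite (mquot_piM _ ([:: Tagged M a] : free_monoid {i : I & M i}) w) mquot_piM.
exact: PM.
Qed.

(** * A single homogeneous Garside monoid *)

Lemma env_inX (N : monoidType) (a : N) n : env_in (a ^+ n) = env_in a ^+ n.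
Proof. exact: gmulfXn. Qed.

Section GarsideMonoid.
Variables (N : monoidType) (Delta : N).
Hypotheses (garsideN : homogeneous_garside Delta) (Delta_neq1 : Delta <> 1).
Implicit Types (a b u v : N).

Lemma garside_mulI a : injective (fun b => a * b).
Proof.
move=> b c; have [mulI _] := garside_cancellative garsideN; exact: mulI.
Qed.

Lemma garside_mulIg a : injective (fun b => b * a).
Proof.
move=> b c; have [_ mulIg] := garside_cancellative garsideN; exact: mulIg.
Qed.

Lemma garside_length :
  exists2 l : N -> nat, {morph l : a b / a * b >-> (a + b)%N} &
    forall a, l a = 0%N -> a = 1.
Proof.
have [l lP] := garside_homogeneous garsideN.
exists l => [a b|a la]; first by rewrite gmulfM.
have [[|b s] sP as_] := lP a; first by rewrite as_ big_nil.
have : (0 < (l b : nat))%N by apply: sP; rewrite mem_head.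
have : (l a : nat) = (l b + l (\prod_(c <- s) c)%g)%N.
  by rewrite as_ big_cons gmulfM.
by rewrite la => /esym/eqP; rewrite addn_eq0 => /andP[/eqP->].
Qed.

(** There are no nontrivial units, since the length is additive. *)
Lemma garside_mul_eq1 a b : a * b = 1 -> a = 1.
Proof.
have [l lM l0] := garside_length; move=> ab.
have /eqP := congr1 l ab; rewrite lM.
have -> : l 1 = 0%N by apply/eqP; rewrite -(eqn_add2l (l 1)) -lM mulg1 addn0.
by rewrite addn_eq0 => /andP[/eqP/l0].
Qed.

Lemma Delta_ndvd1 : ~ ldvd Delta 1.
Proof. by case=> b /esym/garside_mul_eq1. Qed.

Lemma garside_ind (P : N -> Prop) :
  P 1 -> (forall s a, simple Delta s -> P a -> P (s * a)) -> forall a, P a.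
Proof.
move=> P1 PM a; have [s sS ->] := garside_generates garsideN a.
elim: s sS => [|b s IHs] sS; first by rewrite big_nil.
rewrite big_cons; apply: PM; first by apply: sS; rewrite mem_head.
by apply: IHs => c cs; apply: sS; rewrite in_cons cs orbT.
Qed.

(** If [s * t] is [Delta], then [t] is a right-divisor, hence a left-divisor, of
    [Delta]; writing [Delta] as [t * c] gives [s * Delta = s * t * c =
    Delta * c]. Simple elements generate, so the general case follows. *)
Lemma Delta_pushr a : exists b, a * Delta = Delta * b.
Proof.
elim/garside_ind: a => [|s a [t st] [b ab]].
  by exists 1; rewrite mul1g mulg1.
have /(garside_divisors garsideN)[c tc] : rdvd t Delta by exists s.
by exists (c * b); rewrite -mulgA ab mulgA [in LHS]tc mulgA -st mulgA.
Qed.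

Lemma Delta_pushl a : exists b, Delta * a = b * Delta.
Proof.
elim/garside_ind: a => [|s a /(garside_divisors garsideN)[t ts] [b ab]].
  by exists 1; rewrite mul1g mulg1.
have /(garside_divisors garsideN)[c ct] : ldvd t Delta by exists s.
by exists (c * b); rewrite mulgA [in LHS]ct -(mulgA c) -ts -mulgA ab mulgA.
Qed.

Definition twistr a : N := sval (cid (Delta_pushr a)).
Definition twistl a : N := sval (cid (Delta_pushl a)).

Lemma twistrE a : a * Delta = Delta * twistr a.
Proof. exact: svalP (cid (Delta_pushr a)). Qed.

Lemma twistlE a : Delta * a = twistl a * Delta.
Proof. exact: svalP (cid (Delta_pushl a)). Qed.

(** [twist k a] is the conjugate of [a] by [Delta ^ k], the element with
    [a * Delta ^ k = Delta ^ k * twist k a]. For negative [k] this equation only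
    makes sense in the enveloping group; [twistS] expresses it inside the monoid,
    uniformly in the sign of [k]. *)
Definition twist (k : int) a : N :=
  match k with Posz n => iter n twistr a | Negz n => iter n.+1 twistl a end.

Lemma twistS k a : Delta * twist (k + 1)%R a = twist k a * Delta.
Proof.
case: k => [n|[|n]].
- by rewrite -[(_ + 1)%R]/(Posz (n + 1)) addn1 /= twistrE.
- by rewrite /= twistlE.
- rewrite (_ : (Negz n.+1 + 1)%R = Negz n) /= ?twistlE //.
  by rewrite !NegzE -[n.+2]addn1 PoszD GRing.opprD GRing.addrNK.
Qed.

Lemma twist_expg k m a :
  Delta ^+ m * twist (k + Posz m)%R a = twist k a * Delta ^+ m.
Proof.
elim: m k => [|m IHm] k; first by rewrite GRing.addr0 mul1g mulg1.
by rewrite expgSr -mulgA intS GRing.addrCA GRing.addrC twistS mulgA IHm mulgA.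
Qed.

Lemma twistM k a b : twist k (a * b) = twist k a * twist k b.
Proof.
have rM c d : twistr (c * d) = twistr c * twistr d.
  by apply: (garside_mulI (a := Delta));
     rewrite -twistrE mulgA -twistrE -!mulgA -twistrE.
have lM c d : twistl (c * d) = twistl c * twistl d.
  by apply: (garside_mulIg (a := Delta));
     rewrite -twistlE -mulgA -twistlE !mulgA -twistlE.
by case: k => n; rewrite /twist; [|move: n.+1 => {}n]; elim: n => //= n ->.
Qed.

Lemma twist1 k : twist k 1 = 1.
Proof.
have r1 : twistr 1 = 1.
  by apply: (garside_mulI (a := Delta)); rewrite -twistrE mulg1 mul1g.
have l1 : twistl 1 = 1.
  by apply: (garside_mulIg (a := Delta)); rewrite -twistlE mulg1 mul1g.
by case: k => n; rewrite /twist; [|move: n.+1 => {}n]; elim: n => //= n ->.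
Qed.

Lemma twist_Delta k : twist k Delta = Delta.
Proof.
have rD : twistr Delta = Delta.
  by apply: (garside_mulI (a := Delta)); rewrite -twistrE.
have lD : twistl Delta = Delta.
  by apply: (garside_mulIg (a := Delta)); rewrite -twistlE.
by case: k => n; rewrite /twist; [|move: n.+1 => {}n]; elim: n => //= n ->.
Qed.

(** Dividing by [Delta] strictly decreases the length, so the process stops. *)
Lemma Delta_factor a :
  exists p : nat * N, a = Delta ^+ p.1 * p.2 /\ ~ ldvd Delta p.2.
Proof.
have [l lM l0] := garside_length.
elim: {a}(l a).+1 {-2}a (leqnn (l a).+1) => // n IHn a lan.
have [[b ab]|nDa] := pselect (ldvd Delta a); last first.
  by exists (0%N, a); rewrite mul1g.
have [|[m u] /= [bE nDu]] := IHn b.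
  rewrite ltnS in lan; apply: leq_trans lan.
  rewrite ab lM -[X in (X < _)%N]add0n ltn_add2r.
  by rewrite lt0n; apply/eqP => /l0.
by exists (m.+1, u); rewrite expgS -mulgA -bE.
Qed.

Lemma Delta_factor_uniq m n u v : ~ ldvd Delta u -> ~ ldvd Delta v ->
  Delta ^+ m * u = Delta ^+ n * v -> (m, u) = (n, v).
Proof.
move=> nDu nDv; elim: m n => [|m IHm] [|n].
- by rewrite !mul1g => ->.
- by rewrite mul1g expgS -mulgA => uE; case: nDu; exists (Delta ^+ n * v).
- by rewrite mul1g expgS -mulgA => vE; case: nDv; exists (Delta ^+ m * u).
- by rewrite !expgS -!mulgA => /garside_mulI/IHm[-> ->].
Qed.

Definition factor_Delta a : nat * N := sval (cid (Delta_factor a)).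

Lemma factor_DeltaE a : Delta ^+ (factor_Delta a).1 * (factor_Delta a).2 = a.
Proof. by case: (svalP (cid (Delta_factor a))) => /esym. Qed.

Lemma factor_Delta_ndvd a : ~ ldvd Delta (factor_Delta a).2.
Proof. by case: (svalP (cid (Delta_factor a))). Qed.

Lemma factor_Delta_uniq m u : ~ ldvd Delta u ->
  factor_Delta (Delta ^+ m * u) = (m, u).
Proof.
move=> nDu; have := factor_DeltaE (Delta ^+ m * u).
case: (factor_Delta _) (@factor_Delta_ndvd (Delta ^+ m * u)) => n v nDv.
exact: Delta_factor_uniq.
Qed.

(** Left multiplication on fractions: (k, u) stands for [Delta ^ k * u], and
    [a * Delta ^ k * u] is [Delta ^ k * (twist k a * u)], from whose second factor
    the powers of [Delta] are then extracted. *)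
Definition garside_act a (p : int * N) : int * N :=
  let q := factor_Delta (twist p.1 a * p.2) in ((p.1 + Posz q.1)%R, q.2).

Lemma garside_act_ndvd a p : ~ ldvd Delta (garside_act a p).2.
Proof. exact: factor_Delta_ndvd. Qed.

Lemma garside_act1 k u : ~ ldvd Delta u -> garside_act 1 (k, u) = (k, u).
Proof.
move=> nDu; rewrite /garside_act /= twist1 -[1]/(Delta ^+ 0).
by rewrite factor_Delta_uniq //= GRing.addr0.
Qed.

Lemma garside_act_Delta k u :
  ~ ldvd Delta u -> garside_act Delta (k, u) = ((k + 1)%R, u).
Proof.
by move=> nDu; rewrite /garside_act /= twist_Delta (factor_Delta_uniq 1 nDu).
Qed.

Lemma garside_actM a b p :
  garside_act (a * b) p = garside_act a (garside_act b p).
Proof.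
case: p => k u; rewrite /garside_act /=.
have := factor_DeltaE (twist k b * u).
case: (factor_Delta (twist k b * u)) => m v /= bE.
have := factor_DeltaE (twist (k + Posz m)%R a * v).
have := @factor_Delta_ndvd (twist (k + Posz m)%R a * v).
case: (factor_Delta (twist _ a * v)) => n w /= nDw aE.
rewrite twistM -mulgA -bE mulgA -twist_expg -mulgA -aE mulgA -expgnDr.
by rewrite factor_Delta_uniq //= PoszD GRing.addrA.
Qed.

(** On nonnegative exponents the action is multiplication in the monoid. *)
Lemma garside_act_nat a n u : exists m, exists v,
  garside_act a (Posz n, u) = (Posz m, v) /\
  Delta ^+ m * v = a * (Delta ^+ n * u).
Proof.
exists (n + (factor_Delta (twist (Posz n) a * u)).1)%N.
exists (factor_Delta (twist (Posz n) a * u)).2; split=> //.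
rewrite expgnDr -mulgA factor_DeltaE mulgA -(GRing.add0r (Posz n)) twist_expg.
by rewrite mulgA.
Qed.

Lemma Delta_expg_lmultiple a : exists b m, b * a = Delta ^+ m.
Proof.
elim/garside_ind: a => [|s a /(garside_divisors garsideN) [t ts] [b [m ba]]].
  by exists 1, 0%N; rewrite mulg1.
have [c cb] := Delta_pushl b; exists (c * t), m.+1.
by rewrite -mulgA (mulgA t) -ts mulgA -cb -mulgA ba -expgS.
Qed.

Lemma Delta_expg_pushl n a : exists b, Delta ^+ n * a = b * Delta ^+ n.
Proof.
by exists (twist (- Posz n)%R a); rewrite -twist_expg GRing.addNr.
Qed.

(** Otherwise [s * t] would be longer than [Delta]. *)
Lemma Delta_cofactor_eq1 s t : Delta = s * t -> ldvd Delta t -> s = 1.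
Proof.
move=> st [e te]; have [s' sD] := Delta_pushr s.
apply: (garside_mulIg (a := Delta)); rewrite mul1g sD.
rewrite (@garside_mul_eq1 s' e) ?mulg1 //.
by apply: (garside_mulI (a := Delta)); rewrite mulg1 mulgA -sD -mulgA -te.
Qed.

(** Powers of [Delta] are common denominators: a letter [c^-1] equals
    [Delta ^- m * b] with [b * c = Delta ^+ m], and the powers of [Delta] can be
    collected on the left. *)
Lemma env_denominator (g : env_group N) :
  exists n a, env_in Delta ^+ n * g = env_in a.
Proof.
rewrite -[g]env_reprK; elim: (env_repr g) => [|[[] c] w [n [a wa]]].
- by exists 0%N, 1; rewrite env_pi1 mulg1 env_in1.
- have [b [m bc]] := Delta_expg_lmultiple c.
  have [d db] := Delta_expg_pushl n b.
  exists (n + m)%N, (d * a); rewrite (env_piM [:: (true, c)] w).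
  have -> : env_pi [:: (true, c)] = (env_in c)^-1.
    apply/esym/mulg1_eq; rewrite -env_piM -env_pi1.
    by apply/env_piP/MCongBase/EnvInvr.
rewrite expgnDr -mulgA -(env_inX _ m) -bc env_inM -mulgA mulVKg.
  by rewrite mulgA -env_inX -env_inM db !env_inM -mulgA env_inX wa.
- have [d dc] := Delta_expg_pushl n c.
  exists n, (d * a); rewrite (env_piM [:: (false, c)] w) mulgA -env_inX.
  by rewrite -[env_pi _]/(env_in c) -env_inM dc !env_inM -mulgA env_inX wa.
Qed.

End GarsideMonoid.

(* From here on only the five properties of [garside_act] above matter; unfolding
   it would expose choices of factorizations. *)
#[local] Opaque garside_act.

Lemma dp_inX (I : choiceType) (M : I -> monoidType) (Delta : forall i, M i) i
  (a : M i) n : dp_in Delta (a ^+ n) = dp_in Delta a ^+ n.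
Proof. exact: gmulfXn. Qed.

(** * Normal forms in the Delta-product *)

Section NormalForms.
Variables (I : choiceType) (M : I -> monoidType) (Delta : forall i, M i).
Hypotheses (garsideM : forall i, homogeneous_garside (Delta i))
  (Delta_neq1 : forall i, Delta i <> 1).

Local Notation letter := {i : I & M i}.
Local Notation dprod := (delta_product Delta).
Local Notation phi := (dp_in Delta).
Implicit Types (i j : I) (p : letter) (w : seq letter).

Definition starts j w : bool := if w is p :: _ then tag p == j else false.

Fixpoint alternating w : bool :=
  if w is p :: w' then
    [&& `[< tagged p <> 1 /\ ~ ldvd (Delta (tag p)) (tagged p) >],
        ~~ starts (tag p) w' & alternating w']
  else true.

(** Seen from the component [j], a word is a pair of an element of [M j] and a word
    not starting in [M j]. The dependent cast [tagged_as] returns the default [1]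
    when the leading letter belongs to another component. *)
Definition split_head j w : M j :=
  if w is p :: _ then tagged_as (Tagged M (1 : M j)) p else 1.
Definition split_tail j w : seq letter := if starts j w then behead w else w.
Definition join j (u : M j) w : seq letter :=
  if u == 1 then w else Tagged M u :: w.

Lemma split_head_cons j (u : M j) w : split_head j (Tagged M u :: w) = u.
Proof. exact: (@tagged_asE I (fun i => M i) (Tagged M (1 : M j)) u). Qed.

Lemma split_head_else j w : ~~ starts j w -> split_head j w = 1.
Proof.
case: w => //= p w; rewrite /tagged_as.
by case: eqP => //= e /eqP[].
Qed.

Lemma split_joinK j (u : M j) w : ~~ starts j w ->
  split_head j (join u w) = u /\ split_tail j (join u w) = w.
Proof.
move=> njw; rewrite /join; case: eqP => [->|_].
  by rewrite split_head_else // /split_tail (negPf njw).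
by rewrite split_head_cons /split_tail /= eqxx.
Qed.

Lemma splitP j w : alternating w ->
  [/\ join (split_head j w) (split_tail j w) = w,
      ~ ldvd (Delta j) (split_head j w),
      ~~ starts j (split_tail j w) & alternating (split_tail j w)].
Proof.
move=> aw; case: (boolP (starts j w)) => jw; last first.
  rewrite split_head_else // /split_tail (negPf jw); split=> //.
    by rewrite /join eqxx.
  exact: Delta_ndvd1.
case: w jw aw => //= -[i u] w /eqP /= eij; subst j.
move=> /and3P[/asboolP[u1 nDu] iw aw].
rewrite -/(split_head i (Tagged M u :: w)) split_head_cons /split_tail /= eqxx.
by split=> //; rewrite /join; case: eqP.
Qed.

Lemma alternating_join j (u : M j) w : ~ ldvd (Delta j) u -> ~~ starts j w ->
  alternating w -> alternating (join u w).
Proof.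
move=> nDu jw aw; rewrite /join; case: eqP => //= u1; rewrite jw aw !andbT.
exact/asboolP.
Qed.

Definition normal_form : Type := {x : int * seq letter | alternating x.2}.

(** On the exponent and the leading element seen from [j], this is the action of
    [M j] on its own fractions. *)
Definition raw_act j (a : M j) (x : int * seq letter) : int * seq letter :=
  let q := garside_act (garsideM j) (@Delta_neq1 j) a (x.1, split_head j x.2) in
  (q.1, join q.2 (split_tail j x.2)).

Lemma raw_act_alternating j (a : M j) (x : int * seq letter) :
  alternating x.2 -> alternating (raw_act a x).2.
Proof.
case: x => k w /= /(splitP j)[_ _ jw aw]; apply: alternating_join => //.
exact: (@garside_act_ndvd _ _ (garsideM j) (@Delta_neq1 j) a
  (k, split_head j w)).
Qed.

Definition nf_act j (a : M j) : endo normal_form :=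
  fun x => exist _ (raw_act a (sval x)) (raw_act_alternating a (svalP x)).

Lemma nf_act1 j : nf_act (1 : M j) = 1.
Proof.
apply/funext => -[[k w] aw]; apply/val_inj; rewrite /= /raw_act /=.
have [wE nD _ _] := splitP j aw.
by rewrite garside_act1 //= wE.
Qed.

Lemma nf_actM j : {morph @nf_act j : a b / a * b}.
Proof.
move=> a b; apply/funext => -[[k w] aw]; apply/val_inj.
rewrite /= /raw_act /= garside_actM.
have [_ _ jw _] := splitP j aw.
case: (garside_act _ _ b _) => m v /=.
by have [-> ->] := split_joinK v jw.
Qed.

Lemma nf_act_Delta j (x : normal_form) :
  sval (nf_act (Delta j) x) = (((sval x).1 + 1)%R, (sval x).2).
Proof.
case: x => -[k w] aw; rewrite /= /raw_act /=.
have [wE nD _ _] := splitP j aw.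
by rewrite garside_act_Delta //= wE.
Qed.

Lemma nf_act_Delta_invertible j : invertible (nf_act (Delta j)).
Proof.
pose shift (x : normal_form) : normal_form :=
  exist _ (((sval x).1 - 1)%R, (sval x).2) (svalP x).
exists shift; split; apply/funext => x; apply/val_inj.
  pose y := nf_act (Delta j) x.
  rewrite -[LHS]/(((sval y).1 - 1)%R, (sval y).2) nf_act_Delta GRing.addrK.
  by rewrite -surjective_pairing.
by rewrite [LHS]nf_act_Delta /= GRing.subrK -surjective_pairing.
Qed.

(** The right-hand side of [nf_act_Delta] does not depend on [j], which is the
    defining relation of the [Delta]-product. *)
Lemma nf_morphism : exists F : UMagmaMorphism.type dprod (endo normal_form),
  forall j (a : M j), F (phi a) = nf_act a.
Proof.
apply: delta_product_liftP => [j|j|i j]; [exact: nf_act1|exact: nf_actM|].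
by apply/funext => x; apply/val_inj;
  rewrite [LHS]nf_act_Delta [RHS]nf_act_Delta.
Qed.

Definition nf_mor : UMagmaMorphism.type dprod (endo normal_form) :=
  sval (cid nf_morphism).

Lemma nf_morE j (a : M j) : nf_mor (phi a) = nf_act a.
Proof. exact: (svalP (cid nf_morphism)). Qed.

Lemma nf_mor_invertible (y : dprod) : invertible (nf_mor y).
Proof.
elim/delta_product_ind: y => [|j a y IHy].
  by exists 1; rewrite gmulf1 mulg1.
rewrite gmulfM nf_morE; apply: invertibleM IHy.
elim/(garside_ind (garsideM j)): a => [|s a [t st] IHa].
  by rewrite nf_act1; exists 1; rewrite mulg1.
rewrite nf_actM; apply: invertibleM IHa.
have [t' t's] : rdvd s (Delta j).
  by apply/(garside_divisors (garsideM j)); exists t.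
apply: (invertible_of_factor (nf_act_Delta_invertible j) (t := nf_act t)
  (t' := nf_act t')).
  by rewrite -nf_actM -st.
by rewrite -nf_actM -t's.
Qed.

Definition nf0 : normal_form := exist _ (0%R, [::]) isT.

Definition nf (y : dprod) : int * seq letter := sval (nf_mor y nf0).

Lemma nf_phi_mul j (a : M j) y : nf (phi a * y) = raw_act a (nf y).
Proof. by rewrite /nf gmulfM nf_morE. Qed.

Lemma nf_alternating y : alternating (nf y).2.
Proof. exact: svalP (nf_mor y nf0). Qed.

Lemma prod_join j (u : M j) w :
  \prod_(p <- join u w) phi (tagged p) = phi u * \prod_(p <- w) phi (tagged p).
Proof.
rewrite /join; case: eqP => [->|_]; last by rewrite big_cons.
by rewrite dp_in1 mul1g.
Qed.

Lemma nf_mul j (a : M j) y n w : nf y = (Posz n, w) ->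
  exists m v, [/\ nf (phi a * y) = (Posz m, join v (split_tail j w)),
    ~ ldvd (Delta j) v &
    Delta j ^+ m * v = a * (Delta j ^+ n * split_head j w)].
Proof.
move=> yE; rewrite nf_phi_mul yE /raw_act /=.
have [m [v [actE vE]]] :=
  garside_act_nat (garsideM j) (@Delta_neq1 j) a n (split_head j w).
exists m, v; rewrite actE; split=> //.
have := @garside_act_ndvd _ _ (garsideM j) (@Delta_neq1 j) a
  (Posz n, split_head j w).
by rewrite actE.
Qed.

Lemma nf_phi j (z : M j) : exists m v,
  [/\ nf (phi z) = (Posz m, join v [::]), ~ ldvd (Delta j) v &
      Delta j ^+ m * v = z].
Proof.
have nf1 : nf 1 = (Posz 0, [::]) by rewrite /nf gmulf1.
have [m [v [nfE nDv vE]]] := nf_mul z nf1.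
by exists m, v; split; rewrite // -?nfE ?mulg1 // vE !mulg1.
Qed.

(** Elements of the monoid keep the exponent nonnegative, and evaluating the normal
    form gives the element back; so [nf] determines its argument. The index [i0]
    only serves to name [Delta]. *)
Lemma nf_form (i0 : I) y : exists n w, nf y = (Posz n, w) /\
  y = dp_delta Delta i0 ^+ n * \prod_(p <- w) phi (tagged p).
Proof.
elim/delta_product_ind: y => [|j a y [n [w [nfy yE]]]].
  by exists 0%N, [::]; rewrite big_nil mulg1 /nf gmulf1.
have [m [v [nfE nDv vE]]] := nf_mul a nfy.
exists m, (join v (split_tail j w)); split=> //.
have aw : alternating w by have := nf_alternating y; rewrite nfy.
have [wE _ _ _] := splitP j aw; rewrite yE -[in LHS]wE !prod_join.
rewrite (dp_delta_common Delta i0 j) /dp_delta -!dp_inX !mulgA -!dp_inM.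
by rewrite vE mulgA.
Qed.

(** The normal form of [phi a] records the factorization of [a] into a power of
    [Delta] and a [Delta]-free element, hence [a]. *)
Lemma phi_inj j : injective (@dp_in I M Delta j).
Proof.
move=> a b ab; have [m [u [ua nDu <-]]] := nf_phi a.
have [n [v [vb nDv <-]]] := nf_phi b.
move: ua; rewrite ab vb => -[<-] uv.
have [<- _] := @split_joinK j u [::] isT.
by have [<- _] := @split_joinK j v [::] isT; rewrite uv.
Qed.

(** Multiplying by [phi c] changes only the exponent and the leading letter seen
    from [j]. As [phi z] has at most a letter in [M j], nothing can follow that
    letter in [y], so [y] comes from [M j]. *)
Lemma phi_ldvd j (c z : M j) y :
  phi c * y = phi z -> exists2 y', z = c * y' & y = phi y'.
Proof.
move=> cyz; have [n [w [nfy yE]]] := nf_form j y.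
have [m [v [nfE nDv vE]]] := nf_mul c nfy.
have [m0 [u [nfz nDu uE]]] := nf_phi z.
have aw : alternating w by have := nf_alternating y; rewrite nfy.
have [wE _ jw _] := splitP j aw.
move: nfE; rewrite cyz nfz => -[mE uvE].
have [hu tu] := @split_joinK j u [::] isT.
have [hv tv] := split_joinK v jw.
exists (Delta j ^+ n * split_head j w); first by rewrite -vE -uE mE -hu -hv uvE.
rewrite yE -{1}wE prod_join -tv -uvE tu big_nil mulg1.
by rewrite /dp_delta -dp_inX -dp_inM.
Qed.

(** Suppose [Delta] does not divide [z]. Then [phi z] has exponent [0], so
    multiplying by [phi c] extracts no power of [Delta] and for [c <> 1] leaves a
    nontrivial leading letter in [M j], while the only letter of [phi z] lies in
    [M i]. *)
Lemma phi_ldvd_neq i j (c : M j) (z : M i) y : i != j ->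
  phi c * y = phi z -> c = 1 \/ ldvd (Delta i) z.
Proof.
move=> ij cyz; have [n [w [nfy yE]]] := nf_form j y.
have [m [v [nfE nDv vE]]] := nf_mul c nfy.
have [m0 [u [nfz nDu <-]]] := nf_phi z.
case: m0 nfz => [|m0] nfz; last first.
  by right; exists (Delta i ^+ m0 * u); rewrite expgS mulgA.
left; apply/eqP/negPn/negP => /eqP c1.
move: nfE; rewrite cyz nfz => -[mE uvE]; rewrite -mE mul1g in vE.
move: uvE; rewrite {2}/join; case: eqP => [v1|_].
  by case: c1; rewrite v1 in vE; apply: garside_mul_eq1 (esym vE).
rewrite /join; case: eqP => // _ [ijE].
by rewrite ijE eqxx in ij.
Qed.

(** By induction on a word for [c], adding letters on the right: the prefix is some
    [phi s] with [s] in [M i], and the next letter [a] divides the complement of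
    [s]. If [a] lies in [M i] it is absorbed by [s]. If it lies elsewhere, then
    [a] is trivial, or the complement of [s] is [Delta] and [s] is trivial. *)
Lemma simple_delta_product (i0 : I) (c : dprod) :
  simple (dp_delta Delta i0) c ->
  exists j (s : M j), simple (Delta j) s /\ c = phi s.
Proof.
elim/delta_product_indr: c => [|j a c IHc] [d].
  exists i0, 1; split; last by rewrite gmulf1.
  by exists (Delta i0); rewrite mul1g.
rewrite -mulgA => DE; have [|i [s [[t st] cE]]] := IHc.
  by exists (phi a * d).
have [t' t'E adE] : exists2 t', Delta i = s * t' & phi a * d = phi t'.
  by apply: phi_ldvd; rewrite -cE -DE; apply: dp_delta_common.
have [ij|ij] := eqVneq i j.
  subst j; have [e t'e _] := phi_ldvd adE.
  by exists i, (s * a); rewrite cE gmulfM; split=> //; exists e;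
     rewrite -mulgA -t'e.
have [a1|Dt'] := phi_ldvd_neq ij adE.
  by exists i, s; rewrite a1 gmulf1 mulg1; split=> //; exists t.
have s1 := Delta_cofactor_eq1 (garsideM i) t'E Dt'.
exists j, a; split; last by rewrite cE s1 gmulf1 mul1g.
have [e -> _] : exists2 e, Delta j = a * e & d = phi e; last by exists e.
apply: phi_ldvd; rewrite adE; move: t'E; rewrite s1 mul1g => <-.
exact: dp_delta_common.
Qed.

(** A common divisor of [phi (a * b)] and [Delta] is some [phi s]. Within [M i] it
    divides [a] by hypothesis. From another component it is trivial, or [Delta]
    divides [a * b], hence [a], and then it divides [phi a] because it divides
    [Delta]. *)
Lemma phi_greedy_pair i (a b : M i) :
  is_glb (@ldvd (M i)) (a * b) (Delta i) a ->
  is_glb (@ldvd dprod) (phi a * phi b) (dp_delta Delta i) (phi a).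
Proof.
move=> [_ [t at_] glb]; split; first by exists (phi b).
  by exists (phi t); rewrite -gmulfM -at_.
move=> c [d abE] cD; have [j [s [sS cE]]] := simple_delta_product cD.
subst c; have [ij|ij] := eqVneq i j.
  subst j; have [|e abe _] := @phi_ldvd i s (a * b) d; first by rewrite gmulfM.
  have [f ->] : ldvd s a by apply: glb => //; exists e.
  by exists (phi f); rewrite gmulfM.
have [||s1|Dab] := @phi_ldvd_neq i j s (a * b) d => //; first by rewrite gmulfM.
  by exists (phi a); rewrite s1 gmulf1 mul1g.
have [f aE] : ldvd (Delta i) a by apply: glb => //; exists 1; rewrite mulg1.
case: cD => e DE; exists (e * phi f); rewrite mulgA -DE aE.
exact: gmulfM.
Qed.

Lemma env_in_phi_inj i (a b : M i) :
  env_in (phi a) = env_in (phi b) -> a = b.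
Proof.
move=> ab; apply: phi_inj.
have nfab : nf_mor (phi a) = nf_mor (phi b).
  by apply: env_in_eq_morph ab; apply: nf_mor_invertible.
have [n [w [nfa ->]]] := nf_form i (phi a).
have [m [v [nfb ->]]] := nf_form i (phi b).
by move: nfa; rewrite /nf nfab -/(nf _) nfb => -[-> ->].
Qed.

(** If [g] is in the kernel, clear its denominator: [Delta ^+ n * g] is some [a] in
    [M i] with [phi a = phi (Delta ^+ n)], so that [g] is trivial. *)
Lemma env_map_phi_inj i : injective (env_map (@dp_in I M Delta i)).
Proof.
apply: gmulf_inj => g g1; have [n [a gE]] := env_denominator (garsideM i) g.
have aE : Delta i ^+ n = a.
  apply: env_in_phi_inj; rewrite -[in RHS]env_map_in -gE env_mapM g1 mulg1.
  by rewrite -env_inX env_map_in.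
by apply: (mulgI (env_in (Delta i) ^+ n)); rewrite gE -aE env_inX mulg1.
Qed.

End NormalForms.

Theorem proposition3p9 (h : nat) (M : 'I_h -> monoidType)
    (Delta : forall i : 'I_h, M i)
    (hGarside : forall i, homogeneous_garside (Delta i))
    (hM11 : forall i, ~ garside_iso (Delta i) M11_delta)
    (hnontrivial : forall i, Delta i <> 1)
    (i : 'I_h) :
  let phi : M i -> delta_product Delta := @dp_in _ M Delta i in
  let phiG : env_group (M i) -> env_group (delta_product Delta) :=
    env_map (@dp_in _ M Delta i) in
  (forall (x : env_group (M i)) (k : int) (s : seq (M i)),
     left_weighted (Delta i) x k s ->
     left_weighted (dp_delta Delta i) (phiG x) k [seq phi a | a <- s]) /\
  injective phiG.
Proof.
move=> phi phiG; split; last exact: env_map_phi_inj.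
have phi_inj : injective phi by apply: phi_inj.
have phi_simple a : simple (Delta i) a -> simple (dp_delta Delta i) (phi a).
  by case=> b ab; exists (phi b); rewrite /dp_delta ab; apply: gmulfM.
move=> x k s [xE sP [sS sG]]; split.
- rewrite xE /phiG env_mapM; congr (_ * _).
    rewrite /dp_delta -env_map_in.
    by case: k {xE} => n; rewrite /zexpg ?gmulfXVn ?gmulfXn.
  by rewrite gmulf_prod big_map; apply: eq_bigr => a _; apply: env_map_in.
- move=> _ /mapP[a /sP[aS a1 aD] ->]; split; first exact: phi_simple.
    by move=> pa; apply/a1/phi_inj; rewrite pa /phi dp_in1.
  by move=> pa; apply/aD/phi_inj.
- split; first by move=> _ /mapP[a /sS aS ->]; apply: phi_simple.
  move=> j; rewrite size_map => js.
  rewrite !(nth_map 1) ?(ltnW js) //; apply: phi_greedy_pair => //.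
  exact: sG.
Qed.
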